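(* Let $(T,X,\pi)$ be a topologically weakly-mixing semiflow on a non-singleton Polish space $X$ with $T$ an abelian discrete semigroup. Then it is densely multi-dimensional Li-Yorke chaotic.
   Context: A topological semiflow $(T,X,\pi)$ consists of a topological semigroup $T$, a topological space $X$ and a jointly continuous map $\pi\colon T\times X\to X$, $(t,x)\mapsto tx$, with $s(tx)=(st)x$ for all $s,t\in T$, $x\in X$, and $ex=x$ for all $x$ if $T$ has a neutral element $e$. $T$ acts on $X^k$ by $t(x_1,\dots,x_k)=(tx_1,\dots,tx_k)$. For nonempty open $U,V\subseteq X$ let $N_T(U,V)=\{t\in T : U\cap t^{-1}V\neq\emptyset\}$, $t^{-1}V=\{x : tx\in V\}$. The semiflow is topologically weakly-mixing if $N_T(U,V)\cap N_T(U',V')\neq\emptyset$ for all nonempty open $U,V,U',V'\subseteq X$ (equivalently, $(T,X\times X)$ is topologically transitive). $(T,X,\pi)$ is densely multi-dimensional Li-Yorke chaotic if for every increasing sequence $\{F_n\}_{n\ge1}$ of compact subsets of $T$ there is an uncountable dense set $\Theta\subseteq X$ such that for any $k\ge2$ and any distinct $x_1,\dots,x_k\in\Theta$ there are sequences $\{s_n\},\{t_n\}$ in $T$ and a point $p\in X$ with $s_n\notin F_n$ for all $n$, $s_n(x_1,\dots,x_k)\to(x_1,\dots,x_k)$ and $t_n(x_1,\dots,x_k)\to(p,\dots,p)$ as $n\to\infty$. *)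

(* Defs.v *)
From HB Require Import structures.
From mathcomp Require Import all_boot all_order all_algebra.
From mathcomp Require Import all_classical all_reals all_analysis.
Set Implicit Arguments.
Unset Strict Implicit.
Unset Printing Implicit Defensive.

Local Open Scope classical_set_scope.

HB.mixin Record Semigroup_hasContinuousMul T
    & Topological T & monoid.Semigroup T := {
  mulg_continuous : continuous (fun p : T * T => (p.1 * p.2)%g)
}.

#[short(type="topSemigroupType")]
HB.structure Definition TopSemigroup :=
  { T of Topological T & monoid.Semigroup T & Semigroup_hasContinuousMul T }.

(* [T] need not have a neutral element: [act_neutral] constrains the
   action of every neutral element that happens to exist. *)
Record semiflow (T : topSemigroupType) (X : topologicalType) := Semiflow {
  act :> T -> X -> X;
  act_continuous : continuous (fun p : T * X => act p.1 p.2);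
  actM : forall (s t : T) (x : X), act s (act t x) = act (s * t)%g x;
  act_neutral : forall e : T, left_id e *%g -> right_id e *%g ->
    forall x : X, act e x = x
}.

Section semiflow_notions.
Variables (T : topSemigroupType) (X : topologicalType) (phi : semiflow T X).

Definition return_times (U V : set X) : set T :=
  [set t | (U `&` phi t @^-1` V) !=set0].

Definition topologically_weakly_mixing : Prop :=
  forall U V U' V' : set X,
    open U -> U !=set0 -> open V -> V !=set0 ->
    open U' -> U' !=set0 -> open V' -> V' !=set0 ->
    (return_times U V `&` return_times U' V') !=set0.

Definition diag_act (k : nat) (t : T) (x : {ptws 'I_k -> X}) :
  {ptws 'I_k -> X} := fun i => phi t (x i).

Definition densely_multidim_Li_Yorke_chaotic : Prop :=
  forall F : nat -> set T,
    (forall n, compact (F n)) -> (forall n, F n `<=` F n.+1) ->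
  exists Theta : set X,
    [/\ ~ countable Theta,
        dense Theta
      & forall (k : nat) (x : {ptws 'I_k -> X}), (2 <= k)%N ->
          injective x -> (forall i, Theta (x i)) ->
        exists (s t : nat -> T) (p : X),
          [/\ forall n, ~ F n (s n),
              (fun n => diag_act (s n) x) @ \oo --> x
            & (fun n => diag_act (t n) x) @ \oo -->
                ((fun=> p) : {ptws 'I_k -> X})]].

End semiflow_notions.

Definition separable (X : topologicalType) : Prop :=
  exists2 D : set X, countable D & dense D.

(* The library's [completeType] is pointed, so completeness is spelled out for
   a metric space that carries no distinguished point. *)
Definition complete_metric (R : realType) (M : metricType R) : Prop :=
  forall F : set_system M, ProperFilter F -> cauchy F ->
    exists l : M, F --> l.

Definition homeomorphic (X Y : topologicalType) : Prop :=
  exists (f : X -> Y) (g : Y -> X),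
    [/\ cancel f g, cancel g f, continuous f & continuous g].

(* [R] is the field in which the metric takes its values. *)
Definition polish_space (R : realType) (X : topologicalType) : Prop :=
  separable X /\
  exists M : metricType R, complete_metric M /\ homeomorphic X M.

Definition discrete_space (X : topologicalType) : Prop :=
  forall A : set X, open A.

(* Main.v *)
Require Import Defs.
From mathcomp Require Import all_boot all_order all_algebra.
From mathcomp Require Import all_classical all_reals all_analysis.
Set Implicit Arguments.
Unset Strict Implicit.
Unset Printing Implicit Defensive.
Import Order.TTheory GRing.Theory Num.Theory.
Local Open Scope classical_set_scope.

(** The chaotic set found here has more than the required property: fixed
sequences [s], [t] and a fixed point [p] satisfy [s_n x --> x] and
[t_n x --> p] for every point [x] of it. Convergence in a power of the space is
pointwise, so these sequences serve all finite tuples at once.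

As the acting semigroup is abelian, the sets of return times form a filter base
(Furstenberg): the intersection of any two of them contains a third one
([return_times_base]). Hence finitely many conditions of the form
[t U meets V] can be imposed on the same [t]. A given time [f] is missed by some
set of return times ([nonreturn_pair]), so [t] can also be kept out of a finite
set, and compact subsets of a discrete semigroup are finite
([simultaneous_return]).

On a complete metric model of the space, one builds finite lists [L n] of small
nonempty open cells. To pass from [L n] to [L n.+1], the cells of [L n] and
finitely many extra balls, which ensure density, are each split into two
disjoint cells. A single time [s_n] outside [F n] then sends every new cell
[V] into a set meeting [V], and [V] is replaced by its part [V `&` s_n^-1 V]; a
single time [t_n] is used in the same way with target a small ball around [p]
([refinement_step], [refinement_sequence]). Because of this shrinking, all
points of the cells of [L n.+1] are moved by [s_n] within a small distance of
themselves, and by [t_n] within a small distance of [p]. The points which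
eventually stay in the cells therefore satisfy both convergences. Splitting
allows a nested sequence of cells to avoid any prescribed sequence of points,
which by completeness gives a Cantor diagonal argument in every cell
([limit_point_avoiding]): these points form an uncountable dense set. *)

(** * Topological preliminaries *)

Definition nonempty_open (X : topologicalType) (U : set X) :=
  open U /\ U !=set0.

Lemma open_disjoint_nbhs (X : topologicalType) (x y : X) :
  hausdorff_space X -> x <> y ->
  exists A B : set X, [/\ open A, open B, A x, B y & A `&` B = set0].
Proof.
rewrite open_hausdorff => hX /eqP /hX[[A B]] /= [/set_mem Ax /set_mem By].
by move=> [oA oB /eqP AB0]; exists A, B.
Qed.

(** If [K] were infinite, the sets containing all but finitely many points of
[K] would form a filter without cluster point, since singletons are open. *)
Lemma compact_discrete_finite (T : topologicalType) (K : set T) :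
  discrete_space T -> compact K -> finite_set K.
Proof.
move=> dT cK; apply: contrapT => infK.
pose G : set_system T := [set A | finite_set (K `\` A)].
have GF : ProperFilter G.
  split; first by rewrite /G /= setD0.
  split; first by rewrite /G /= setDT.
  - by move=> P Q GP GQ; rewrite /G /= setDIr finite_setU.
  - by move=> P Q PQ; apply: sub_finite_set => x [Kx nQx]; split=> // /PQ.
have GK : G K by rewrite /G /= setDv.
have [t [Kt]] := cK G GF GK.
have Gt : G (~` [set t]).
  by apply: (@sub_finite_set _ _ [set t]) => // x [_ /contrapT].
by move=> /(_ _ [set t] Gt)[|x []//]; apply: open_nbhs_nbhs; split.
Qed.

Lemma ptws_cvg (I : Type) (X : topologicalType) (S : Type)
    (G : set_system S) (u : S -> {ptws I -> X}) (l : {ptws I -> X}) :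
  Filter G -> (forall i, (fun z => u z i) @ G --> l i) -> u @ G --> l.
Proof.
move=> FG ul; apply/cvg_sup => i A /= [_ [[B oB <-] Bl] BA].
by apply: filterS BA _; apply: (ul i); apply: open_nbhs_nbhs.
Qed.

(** * Return times of a weakly mixing abelian action *)

Section return_times.
Variables (T : topSemigroupType) (X : topologicalType) (phi : semiflow T X).
Hypothesis mulC : commutative (fun s t : T => (s * t)%g).
Hypothesis wm : topologically_weakly_mixing phi.

Lemma act_cts t : continuous (phi t).
Proof.
move=> x; apply: (@continuous_comp _ _ _ (fun y => (t, y)) (fun p => phi p.1 p.2)).
  by apply: cvg_pair; [exact: cvg_cst|exact: cvg_id].
exact: act_continuous.
Qed.

Lemma actC s t x : phi s (phi t x) = phi t (phi s x).
Proof. by rewrite !actM mulC. Qed.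

Lemma nonempty_open_visit t U V : open U -> open V ->
  return_times phi U V t -> nonempty_open (U `&` phi t @^-1` V).
Proof.
move=> oU oV ne; split=> //; apply: openI => //.
by apply: open_comp => // x _; exact: act_cts.
Qed.

(** Furstenberg's intersection lemma. Weak mixing gives one [t] moving points of
[U] into [U'] and points of [V] into [V']; if [s] then moves a point [w] of
[U `&` t^-1 U'] into [V `&` t^-1 V'], it also moves [t w], a point of [U'], to
[s (t w) = t (s w)], a point of [V']. *)
Lemma return_times_base U V U' V' :
  nonempty_open U -> nonempty_open V -> nonempty_open U' -> nonempty_open V' ->
  exists W Z, [/\ nonempty_open W, nonempty_open Z &
    return_times phi W Z `<=` return_times phi U V `&` return_times phi U' V'].
Proof.
move=> [oU nU] [oV nV] [oU' nU'] [oV' nV'].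
have [t [tU tV]] := wm oU nU oU' nU' oV nV oV' nV'.
exists (U `&` phi t @^-1` U'), (V `&` phi t @^-1` V').
split; [exact: nonempty_open_visit..|].
move=> s [w [[Uw U'w] [Vw V'w]]]; split; first by exists w.
by exists (phi t w); split=> //=; rewrite actC.
Qed.

Lemma return_times_base_seq (l : seq (set X * set X)) : inhabited X ->
  {in l, forall p, nonempty_open p.1 /\ nonempty_open p.2} ->
  exists W Z, [/\ nonempty_open W, nonempty_open Z &
    {in l, forall p, return_times phi W Z `<=` return_times phi p.1 p.2}].
Proof.
move=> [x0]; elim: l => [|q l IH] nol.
  by exists setT, setT; split=> //; split; [exact: openT|exists x0|
    exact: openT|exists x0].
have [|W [Z [nW nZ WZ]]] := IH.
  by move=> p pl; apply: nol; rewrite inE pl orbT.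
have [nq1 nq2] := nol q (mem_head _ _).
have [W' [Z' [nW' nZ' WZ']]] := return_times_base nW nZ nq1 nq2.
exists W', Z'; split=> // p; rewrite inE => /orP[/eqP ->|pl] t /WZ'[]//.
by move=> ? _; exact: (WZ p pl).
Qed.

(** Take [A] and [B] disjoint: if [t^-1 A] is nonempty, [t] sends none of its
points into [B]; otherwise [t] sends no point at all into [A]. *)
Lemma nonreturn_pair t : hausdorff_space X -> (exists x y : X, x <> y) ->
  exists p : set X * set X,
    [/\ nonempty_open p.1, nonempty_open p.2 & ~ return_times phi p.1 p.2 t].
Proof.
move=> hX [x [y xy]].
have [A [B [oA oB Ax By AB0]]] := open_disjoint_nbhs hX xy.
have [[z Az]|nA] := pselect (phi t @^-1` A !=set0).
  exists (phi t @^-1` A, B); split=> /=.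
  - by split; [apply: open_comp => // ? _; exact: act_cts|exists z].
  - by split=> //; exists y.
  - move=> [w [Aw Bw]]; suff : (A `&` B) (phi t w) by rewrite AB0.
    by [].
exists (setT, A); split=> /=.
- by split; [exact: openT|exists x].
- by split=> //; exists x.
- by move=> [w [_ Aw]]; apply: nA; exists w.
Qed.

(** Avoiding the times in [F] amounts to adding, for each of them, a pair of open
sets for which it is not a return time. *)
Lemma simultaneous_return (F : seq T) (l : seq (set X * set X)) :
  hausdorff_space X -> (exists x y : X, x <> y) ->
  {in l, forall p, nonempty_open p.1 /\ nonempty_open p.2} ->
  exists2 t, t \notin F & {in l, forall p, return_times phi p.1 p.2 t}.
Proof.
move=> hX X2 nol.
have [e /all_and3[e1 e2 eN]] := choice (fun t => nonreturn_pair t hX X2).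
have iX : inhabited X by case: X2.
have [|W [Z [[oW nW] [oZ nZ] WZ]]] :=
    @return_times_base_seq (l ++ map e F) iX.
  by move=> p; rewrite mem_cat => /orP[/nol//|/mapP[f _ ->]].
have [t [tWZ _]] := wm oW nW oZ nZ oW nW oZ nZ.
exists t => [|p pl]; last by apply: WZ tWZ; rewrite mem_cat pl.
apply/negP => tF; apply: (eN t); apply: WZ tWZ.
by rewrite mem_cat map_f ?orbT.
Qed.

(** A weakly mixing space with two points has no isolated point: some [t] sends
one part of [U] into [A] and another one into [B], for disjoint [A] and [B]. *)
Lemma disjoint_pieces U : hausdorff_space X -> (exists x y : X, x <> y) ->
  nonempty_open U -> exists V : bool -> set X,
    [/\ forall b, nonempty_open (V b), forall b, V b `<=` U &
        V true `&` V false = set0].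
Proof.
move=> hX [x [y xy]] [oU nU].
have [A [B [oA oB Ax By AB0]]] := open_disjoint_nbhs hX xy.
have [t [tA tB]] : (return_times phi U A `&` return_times phi U B) !=set0.
  by apply: wm => //; [exists x|exists y].
exists (fun b => U `&` phi t @^-1` (if b then A else B)); split=> [[]|b z []//|].
- exact: nonempty_open_visit.
- exact: nonempty_open_visit.
- rewrite -subset0 => z [[_ Az] [_ Bz]].
  by suff : (A `&` B) (phi t z) by rewrite AB0.
Qed.

End return_times.

(** * Refining finite families of cells *)

Section cells.
Variables (R : realType) (M : metricType R).

Lemma small_cell (U : set M) (e : R) : (0 < e)%R -> nonempty_open U ->
  exists V, [/\ nonempty_open V, closure V `<=` U &
    forall x y, V x -> V y -> ball x e y].
Proof.
move=> e0 [oU [u Uu]]; have e20 : (0 < e / 2)%R by rewrite divr_gt0.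
have [W Wu WU] := @uniform_regular M u U (open_nbhs_nbhs (conj oU Uu)).
pose V := (W `&` ball u (e / 2))°.
have VW : V `<=` W by move=> z /nbhs_singleton[].
exists V; split.
- split; first exact: open_interior.
  by exists u; apply: filterI => //; exact: nbhsx_ballx.
- exact: subset_trans (closureS VW) WU.
- move=> x y /nbhs_singleton[_ ux] /nbhs_singleton[_ uy].
  by apply: ball_splitr ux uy.
Qed.

Variables (T : topSemigroupType) (phi : semiflow T M).
Hypothesis mulC : commutative (fun s t : T => (s * t)%g).
Hypothesis wm : topologically_weakly_mixing phi.
Hypothesis M2 : exists x y : M, x <> y.
Variable p : M.

Definition nonempty_opens (L : seq (set M)) := {in L, forall U, nonempty_open U}.

(** The point [x] is arbitrary, so that a descending choice of cells can escape
any sequence of points; closures are taken to keep limits inside the cells. *)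
Definition separating_refinement (L L' : seq (set M)) :=
  {in L, forall U x, exists2 V, V \in L' & closure V `<=` U /\ ~ V x}.

(** The bound on the diameters makes nested cells shrink to a point; the two
others become the convergences [s_n x --> x] and [t_n x --> p]. *)
Definition controlled (e : R) (s t : T) (L : seq (set M)) :=
  {in L, forall V x y, V x -> V y ->
    [/\ ball x e y, ball x e (phi s x) & ball p e (phi t x)]}.

(** The families are finite, so one [s] returns all the new cells to themselves
and one [t] brings them all close to the base point; intersecting with the
preimages turns this into a property of all points of the cells. *)
Lemma refinement_step (L : seq (set M)) (F : seq T) (e : R) :
  (0 < e)%R -> nonempty_opens L ->
  exists L' s t, [/\ nonempty_opens L', s \notin F,
    separating_refinement L L' & controlled e s t L'].
Proof.
move=> e0 nL.
have hM : hausdorff_space M := @metric_hausdorff _ M.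
have pieces (U : set M) : exists V : bool -> set M, nonempty_open U ->
    [/\ forall b, nonempty_open (V b), forall b, closure (V b) `<=` U,
        forall b x y, V b x -> V b y -> ball x e y
      & V true `&` V false = set0].
  have [nU|] := pselect (nonempty_open U); last by exists (fun=> setT).
  have [W [nW WU W0]] := disjoint_pieces wm hM M2 nU.
  have [V /all_and3[nV VW Ve]] := choice (fun b => small_cell e0 (nW b)).
  exists V => _; split=> //.
    by move=> b; apply: subset_trans (VW b) (WU b).
  rewrite -subset0 -W0 => z [V1z V0z].
  by split; apply: VW; exact: subset_closure.
have [V {pieces}PV] := choice pieces.
pose L1 := [seq V U b | U <- L, b <- [:: true; false]].
have L1P W : W \in L1 -> exists U b, U \in L /\ W = V U b.
  by move=> /allpairsP[[U b] /= [UL _ ->]]; exists U, b.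
have nL1 W : W \in L1 -> nonempty_open W.
  by move=> /L1P[U [b [UL ->]]]; have [] := PV _ (nL _ UL).
have [|s sF sL1] := @simultaneous_return _ _ _ mulC wm F
    [seq (W, W) | W <- L1] hM M2.
  by move=> q /mapP[W /nL1 nW ->].
pose back W := W `&` phi s @^-1` W.
have nback W : W \in L1 -> nonempty_open (back W).
  move=> WL; have [oW _] := nL1 _ WL.
  by apply: nonempty_open_visit => //; exact: (sL1 _ (map_f _ WL)).
pose B := (ball p e)°.
have nB : nonempty_open B.
  by split; [exact: open_interior|exists p; exact: nbhsx_ballx].
have [|t _ tL1] := @simultaneous_return _ _ _ mulC wm [::]
    [seq (back W, B) | W <- L1] hM M2.
  by move=> q /mapP[W /nback nW ->].
pose cell W := back W `&` phi t @^-1` B.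
have cellS W : cell W `<=` W by move=> z [[]].
exists [seq cell W | W <- L1], s, t; split=> //.
- move=> _ /mapP[W WL ->]; have [orW _] := nback _ WL.
  apply: nonempty_open_visit => //; first by case: nB.
  exact: (tL1 _ (map_f _ WL)).
- move=> U UL x; have [_ clV _ V0] := PV _ (nL _ UL).
  have [b nVb] : exists b, ~ V U b x.
    apply/existsNP => Vx; suff : (V U true `&` V U false) x by rewrite V0.
    by [].
  exists (cell (V U b)).
    by apply/map_f/allpairsP; exists (U, b); split=> //; case: (b).
  split; last by move/cellS.
  exact: subset_trans (closureS (@cellS _)) (clV b).
- move=> _ /mapP[_ /L1P[U [b [UL ->]]] ->] x y Vx Vy.
  have [_ _ Ve _] := PV _ (nL _ UL).
  move: Vx (cellS _ _ Vy) => [[Vx Vsx] Btx] {}Vy; split.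
  + exact: Ve Vx Vy.
  + exact: Ve Vx Vsx.
  + exact: nbhs_singleton Btx.
Qed.

(** [N n] lists the open sets in which new cells are started at stage [n]. *)
Lemma refinement_sequence (F : nat -> seq T) (e : nat -> R)
    (N : nat -> seq (set M)) :
  (forall n, 0 < e n)%R -> (forall n, nonempty_opens (N n)) ->
  exists (L : nat -> seq (set M)) (s t : nat -> T), forall n,
    [/\ nonempty_opens (L n), s n \notin F n,
        separating_refinement (L n ++ N n) (L n.+1)
      & controlled (e n) (s n) (t n) (L n.+1)].
Proof.
move=> e0 nN.
have step (nL : nat * seq (set M)) : exists r : seq (set M) * T * T,
    nonempty_opens nL.2 ->
    [/\ nonempty_opens r.1.1, r.1.2 \notin F nL.1,
        separating_refinement (nL.2 ++ N nL.1) r.1.1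
      & controlled (e nL.1) r.1.2 r.2 r.1.1].
  case: nL => n L /=.
  (* a choice function needs a value for every [L]; when some member of [L] is
     empty or not open, the step is applied to the empty family instead *)
  have [|L' [s [t H]]] := @refinement_step
      (if `[< nonempty_opens L >] then L ++ N n else [::]) (F n) (e n) (e0 n).
    by case: asboolP => // ? U; rewrite mem_cat => /orP[]; auto; apply: nN.
  by exists (L', s, t) => nL; move: H; rewrite (asboolT nL).
have [h hP] := choice step.
pose L := fix L n := if n is m.+1 then (h (m, L m)).1.1 else [::].
have nL n : nonempty_opens (L n).
  by elim: n => [//|n IH] /=; have [] := hP (n, L n) IH.
exists L, (fun n => (h (n, L n)).1.2), (fun n => (h (n, L n)).2) => n.
by have [? ? ? ?] := hP (n, L n) (nL n); split.
Qed.

(** The cells need not be nested from the first stage on, because new ones are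
started at every stage. *)
Definition limit_points (L : nat -> seq (set M)) : set M :=
  [set x | exists m, forall n, (m <= n)%N -> exists2 V, V \in L n & V x].

(** Cantor's diagonal argument: descend from [U] through cells whose closures are
nested, leaving out [g k] at the [k]-th step; completeness provides a point
common to all of them. *)
Lemma limit_point_avoiding (L : nat -> seq (set M)) (e : nat -> R) m U
    (g : nat -> M) :
  complete_metric M ->
  (forall n, nonempty_opens (L n)) ->
  (forall n, separating_refinement (L n) (L n.+1)) ->
  (forall n, {in L n.+1, forall V x y, V x -> V y -> ball x (e n) y}) ->
  (forall d, 0 < d -> \forall n \near \oo, e n < d)%R ->
  U \in L m ->
  exists x, [/\ U x, limit_points L x & forall n, x <> g n].
Proof.
move=> cM nL sepL diamL e0 UL.
have next (kV : nat * set M) : exists V' : set M, kV.2 \in L (m + kV.1)%N ->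
    [/\ V' \in L (m + kV.1.+1)%N, closure V' `<=` kV.2 & ~ V' (g kV.1)].
  case: kV => k V /=.
  have [VL|] := boolP (V \in L _); last by exists setT.
  by have [V' ? []] := sepL _ _ VL (g k); rewrite addnS; exists V'.
have [h hP] := choice next.
pose C := fix C n := if n is k.+1 then h (k, C k) else U.
have CL k : C k \in L (m + k)%N.
  elim: k => [|k IH]; first by rewrite addn0.
  by have [] := hP (k, C k) IH.
have CS k : closure (C k.+1) `<=` C k by have [] := hP (k, C k) (CL k).
have Cg k : ~ C k.+1 (g k) by have [] := hP (k, C k) (CL k).
have Cle j k : (j <= k)%N -> C k `<=` C j.
  move=> /subnK <-; elim: (k - j)%N => // i IH.
  by apply: subset_trans IH; apply: subset_trans (CS _); exact: subset_closure.
have [u uP] := choice (fun k => (nL _ _ (CL k)).2).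
have [l ul] : exists l : M, u @ \oo --> l.
  apply: cM; apply: cauchy_exP => d d0.
  (* cells of [L n.+1] have diameter at most [e n], whence the shift of [N] *)
  have [N _ /(_ (m + N)%N (leq_addl _ _)) eN] := e0 d d0.
  exists (u N.+1); exists N.+1 => // n Nn.
  have VL : C N.+1 \in L (m + N).+1 by rewrite -addnS.
  apply: le_ball (ltW eN) _ _; exact: diamL VL _ _ (uP _) (Cle _ _ Nn _ (uP _)).
have lC k : C k l.
  apply: CS; apply: (closed_cvg _ (@closed_closure _ _) _ _ ul).
  by exists k.+1 => // n kn; apply: subset_closure; exact: Cle kn _ (uP n).
exists l; split; first exact: (lC 0).
- by exists m => n mn; exists (C (n - m)%N) => //; have := CL (n - m)%N; rewrite subnKC.
- by move=> n ln; apply: (Cg n); rewrite -ln.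
Qed.

(** The cells are started in the balls of radius [e n] around the first points
[d i] of a dense sequence: every open set then contains a cell, hence a limit
point. Enumerating the limit points would contradict
[limit_point_avoiding]. *)
Lemma common_return_sequences (F : nat -> seq T) :
  complete_metric M -> separable M ->
  exists (s t : nat -> T) (Theta : set M),
    [/\ forall n, s n \notin F n, ~ countable Theta, dense Theta
      & forall x, Theta x -> phi (s n) x @[n --> \oo] --> x /\
                             phi (t n) x @[n --> \oo] --> p].
Proof.
move=> cM [D cD dD].
(* [d] lists [D], with the value [p] at the indices that code no point of [D] *)
have [d dP] : exists d : nat -> M, forall O, nonempty_open O -> exists i, O (d i).
  have /countable_injP[c cI] := cD.
  exists (fun n => xget p (D `&` c @^-1` [set n])) => O [oO nO].
  have [x [Ox Dx]] := dD O nO oO; exists (c x).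
  suff -> : xget p (D `&` c @^-1` [set c x]) = x by [].
  by apply: xget_unique => // y [Dy /cI]; apply; exact: mem_set.
pose e n : R := (n.+1%:R^-1)%R.
have e0 n : (0 < e n)%R by rewrite invr_gt0.
have e_lt d' : (0 < d' -> \forall n \near \oo, e n < d')%R.
  by move=> d'0; exact: (near_infty_natSinv_lt (PosNum d'0)).
pose N n := [seq (ball (d i) (e n))° | i <- iota 0 n.+1].
have nN n : nonempty_opens (N n).
  move=> _ /mapP[i _ ->]; split; first exact: open_interior.
  by exists (d i); exact: nbhsx_ballx.
have [L [s [t /all_and4[nL sF sepL ctrlL]]]] := refinement_sequence F e0 nN.
have sepLL n : separating_refinement (L n) (L n.+1).
  by move=> U UL; apply: sepL; rewrite mem_cat UL.
have avoid m U (g : nat -> M) : U \in L m ->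
    exists x, [/\ U x, limit_points L x & forall n, x <> g n].
  apply: limit_point_avoiding cM nL sepLL _ e_lt.
  by move=> n V VL x y Vx Vy; have [] := ctrlL _ _ VL x y Vx Vy.
exists s, t, (limit_points L); split=> //.
- move=> /countable_injP[c cI].
  (* a limit point different from all the points that the code [c] enumerates *)
  have UN : (ball (d 0%N) (e 0%N))° \in L 0%N ++ N 0%N.
    by rewrite mem_cat; apply/orP; right; exact: (map_f (fun i => (ball (d i) _)°)).
  have [V VL _] := sepL 0%N _ UN p.
  have [x [_ Lx xg]] :=
    avoid _ _ (fun n => xget p (limit_points L `&` c @^-1` [set n])) VL.
  apply: (xg (c x)); apply/esym/xget_unique => // y [Ly /cI].
  by apply; exact: mem_set.
- move=> O nO oO; have [i Oi] := dP O (conj oO nO).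
  have /nbhs_ballP[r r0 rO] := open_nbhs_nbhs (conj oO Oi).
  have [k _ kP] := e_lt _ r0.
  pose n := maxn i k.
  have UN : (ball (d i) (e n))° \in L n ++ N n.
    rewrite mem_cat; apply/orP; right.
    apply: (map_f (fun i => (ball (d i) _)°)).
    by rewrite mem_iota leq0n add0n ltnS leq_maxl.
  have [V VL [VU _]] := sepL n _ UN p.
  have [x [Vx Lx _]] := avoid _ _ (fun=> p) VL.
  exists x; split=> //; apply: rO.
  apply: le_ball (ltW (kP n (leq_maxr _ _))) _ _.
  by have /nbhs_singleton := VU _ (subset_closure Vx).
- move=> x [m mP].
  have ctrl n : (m <= n)%N -> ball x (e n) (phi (s n) x) /\
                             ball p (e n) (phi (t n) x).
    move=> mn; have [V VL Vx] := mP n.+1 (leqW mn).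
    by have [] := ctrlL n V VL x x Vx Vx.
  by split; apply/cvg_ballP => r r0; near=> n;
    (apply: (@le_ball _ _ _ (e n)); first by apply: ltW; near: n; exact: e_lt);
    apply ctrl; near: n; exists m.
Unshelve. all: by end_near.
Qed.
End cells.

(** * Transport along a homeomorphism *)

Section conjugacy.
Variables (T : topSemigroupType) (X Y : topologicalType) (phi : semiflow T X).
Variables (f : X -> Y) (g : Y -> X).
Hypotheses (fK : cancel f g) (gK : cancel g f).
Hypotheses (cf : continuous f) (cg : continuous g).

Lemma conj_act_continuous :
  continuous (fun p : T * Y => f (phi p.1 (g p.2))).
Proof.
move=> q.
apply: (@continuous_comp _ _ _ (fun p : T * Y => phi p.1 (g p.2)) f); last exact: cf.
apply: (@continuous_comp _ _ _ (fun p : T * Y => (p.1, g p.2)) (fun p => phi p.1 p.2)).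
  apply: cvg_pair => /=; first exact: cvg_fst.
  by apply: cvg_comp; [exact: cvg_snd|exact: cg].
exact: act_continuous.
Qed.

Lemma conj_actM s t y : f (phi s (g (f (phi t (g y))))) = f (phi (s * t)%g (g y)).
Proof. by rewrite fK actM. Qed.

Lemma conj_act_neutral e : left_id e *%g -> right_id e *%g ->
  forall y, f (phi e (g y)) = y.
Proof. by move=> l r y; rewrite act_neutral. Qed.

Definition conj_semiflow : semiflow T Y :=
  Semiflow conj_act_continuous conj_actM conj_act_neutral.

Lemma conj_weakly_mixing :
  topologically_weakly_mixing phi -> topologically_weakly_mixing conj_semiflow.
Proof.
have pre U : open U -> U !=set0 -> open (f @^-1` U) /\ (f @^-1` U) !=set0.
  move=> oU [y Uy]; split; first by apply: open_comp => // x _; exact: cf.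
  by exists (g y); rewrite /= gK.
have post U V : return_times phi (f @^-1` U) (f @^-1` V) `<=`
    return_times conj_semiflow U V.
  by move=> t [x [Ux Vx]]; exists (f x); split=> //=; rewrite fK.
move=> wm U V U' V' /pre nU /nU[oU {}nU] /pre nV /nV[oV {}nV].
move=> /pre nU' /nU'[oU' {}nU'] /pre nV' /nV'[oV' {}nV'].
have [t [tU tU']] := wm _ _ _ _ oU nU oV nV oU' nU' oV' nV'.
by exists t; split; exact: post.
Qed.

Lemma dense_preimage_homeo (D : set Y) : dense D -> dense (f @^-1` D).
Proof.
move=> dD O [x Ox] oO.
have oOg : open (g @^-1` O) by apply: open_comp => // y _; exact: cg.
have [|y [Oy Dy]] := dD (g @^-1` O) _ oOg.
  by exists (f x); rewrite /= fK.
by exists (g y); split=> //=; rewrite gK.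
Qed.

Lemma countable_preimage_bij (D : set Y) : countable (f @^-1` D) -> countable D.
Proof.
apply: sub_countable; apply: card_le_trans (card_image_le f _).
by apply: subset_card_le => y Dy; exists (g y); rewrite /= gK.
Qed.

End conjugacy.

(** * Dense multi-dimensional Li-Yorke chaos *)

Theorem proposition3p13 (R : realType) (T : topSemigroupType)
    (X : topologicalType) (phi : semiflow T X) :
  discrete_space T ->
  commutative (fun s t : T => (s * t)%g) ->
  polish_space R X ->
  (exists x y : X, x <> y) ->
  topologically_weakly_mixing phi ->
  densely_multidim_Li_Yorke_chaotic phi.
Proof.
move=> dT mulC [[D cD dD] [M [cM [f [g [fK gK cf cg]]]]]] [x0 [y0 xy0]] wm F cF _.
have [Fs FsE] := choice (fun n =>
  (finite_seqP _).1 (compact_discrete_finite dT (cF n))).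
(* the action is moved to the complete metric model [M] of the space *)
pose psi := conj_semiflow phi fK gK cf cg.
have M2 : exists x y : M, x <> y.
  by exists (f x0), (f y0) => /(can_inj fK).
have sM : separable M.
  exists (g @^-1` D); last exact: dense_preimage_homeo gK fK cf _ dD.
  apply: (countable_preimage_bij (f := f)) => //.
  suff -> : f @^-1` (g @^-1` D) = D by [].
  by apply/seteqP; split=> x /=; rewrite fK.
have [s [t [Th [sF unc dTh cvgs]]]] := common_return_sequences mulC
  (conj_weakly_mixing fK gK cf cg wm) M2 (f x0) Fs cM sM.
exists (f @^-1` Th); split.
- by move/(countable_preimage_bij gK).
- exact: dense_preimage_homeo fK gK cg _ dTh.
have cvgX (r : nat -> T) x l : psi (r n) (f x) @[n --> \oo] --> f l ->
    phi (r n) x @[n --> \oo] --> l.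
  move=> rl; rewrite -[l]fK.
  have -> : (fun n => phi (r n) x) = (fun n => g (psi (r n) (f x))).
    by apply/funext => n /=; rewrite !fK.
  by apply: continuous_cvg rl; exact: cg.
move=> k x _ _ Tx; exists s, t, x0; split.
- by move=> n; rewrite FsE; exact/negP.
- by apply: ptws_cvg => i; apply: cvgX; have [] := cvgs _ (Tx i).
- by apply: ptws_cvg => i; apply: cvgX; have [] := cvgs _ (Tx i).
Qed.
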